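(* Let $n\ge 1$, let $x$ be a scalar, and let $T_n(x)$ be the $n\times n$ upper-triangular Toeplitz matrix whose diagonal entries are $1$, whose entries on the first superdiagonal (positions $(i,i+1)$) are $x$, and whose other entries are $0$. Let $N_n$ be the $n\times n$ nilpotent matrix with ones on the first superdiagonal and zeros elsewhere. Then for any integer $k\ge 0$, $$T_n(x)^k=\sum_{j=0}^{\min(k,n-1)}\binom{k}{j}x^j N_n^j.$$
   Context: By convention $T_n(x)^0=N_n^0=I_n$, the $n\times n$ identity matrix, and $x^0=1$. *)

(* Defs.v *)
From HB Require Import structures.
From mathcomp Require Import all_boot all_order all_algebra.

Set Implicit Arguments.
Unset Strict Implicit.
Unset Printing Implicit Defensive.

Import GRing.Theory.
Local Open Scope ring_scope.

(* Indices are 0-based ordinals, so the first superdiagonal is j = i + 1 (as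
   natural numbers, without wrap-around) in either indexing. *)
Definition toeplitz_T (R : comPzRingType) (n : nat) (x : R) : 'M[R]_n :=
  \matrix_(i < n, j < n)
    if i == j then 1 else if (j : nat) == i.+1 then x else 0.

Definition nilpotent_N (R : comPzRingType) (n : nat) : 'M[R]_n :=
  \matrix_(i < n, j < n) if (j : nat) == i.+1 then 1 else 0.
Arguments nilpotent_N {R} n.
Arguments toeplitz_T {R} n x.

(* Main.v *)
Require Import Defs.
From HB Require Import structures.
From mathcomp Require Import all_boot all_order all_algebra.

Set Implicit Arguments.
Unset Strict Implicit.
Unset Printing Implicit Defensive.

Import GRing.Theory.
Local Open Scope ring_scope.

(** The matrix [toeplitz_T n x] is [1 + x *: nilpotent_N n], and the identity
    commutes with everything, so its powers are given by the binomial theorem.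
    The powers of [nilpotent_N n] are the shifted diagonals
    ([nilpotent_N_expE]); the [j]-th one leaves the matrix once [j >= n], which
    is why the binomial sum may stop at [minn k (n - 1)]. *)

(** As [R] is commutative, scalars pull out of either factor of a matrix
    product. In contrast with [exprZn], the trivial cases [n = 0] and [R = 0]
    are covered. *)
Lemma scalemx_exp (R : comPzRingType) (n m : nat) (a : R) (A : 'M[R]_n) :
  (a *: A) ^+ m = a ^+ m *: A ^+ m.
Proof.
elim: m => [|m IHm]; first by rewrite !expr0 scale1r.
by rewrite !exprS IHm -!mulmxE -scalemxAl -scalemxAr scalerA.
Qed.

Lemma toeplitz_TE (R : comPzRingType) (n : nat) (x : R) :
  toeplitz_T n x = x *: nilpotent_N n + 1.
Proof.
apply/matrixP=> i j; rewrite !mxE; case: eqVneq => [->|_].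
  by rewrite ltn_eqF // mulr0 add0r.
by rewrite addr0; case: ifP; rewrite ?mulr1 ?mulr0.
Qed.

(** Left multiplication by [nilpotent_N n] moves every row up by one, so each
    further factor moves the diagonal of ones one step to the right. *)
Lemma nilpotent_N_expE (R : comPzRingType) (n m : nat) (i j : 'I_n) :
  (nilpotent_N n ^+ m : 'M[R]_n) i j = ((j : nat) == (i + m)%N)%:R.
Proof.
elim: m i => [|m IHm] i; first by rewrite expr0 mxE addn0 -val_eqE eq_sym.
rewrite exprS mxE; have [lt_i1n | le_ni1] := ltnP i.+1 n.
  rewrite (bigD1 (Ordinal lt_i1n)) //= big1 => [|l ne_l].
    by rewrite mxE eqxx mul1r addr0 IHm addSnnS.
  by rewrite mxE -[_ == i.+1]/(l == Ordinal lt_i1n) (negPf ne_l) mul0r.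
(* Row [i] is the last one: there is no row below it to move up, and the column
   [i + m.+1 >= n] lies outside the matrix. *)
rewrite big1 => [|l _].
  by rewrite ltn_eqF // addnS (leq_trans (ltn_ord j)) // (leq_trans le_ni1) //
    ltnS leq_addr.
by rewrite mxE ltn_eqF ?mul0r // (leq_trans (ltn_ord l)).
Qed.

Lemma nilpotent_N_exp_eq0 (R : comPzRingType) (n m : nat) :
  (n <= m)%N -> nilpotent_N n ^+ m = 0 :> 'M[R]_n.
Proof.
move=> le_nm; apply/matrixP=> i j; rewrite nilpotent_N_expE mxE ltn_eqF //.
by rewrite (leq_trans (ltn_ord j)) // (leq_trans le_nm) ?leq_addl.
Qed.

Theorem proposition8p2 (R : comPzRingType) (n : nat) (hn : (1 <= n)%N) (x : R)
    (k : nat) :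
  toeplitz_T n x ^+ k =
  \sum_(0 <= j < (minn k (n - 1)).+1)
    ('C(k, j)%:R * x ^+ j) *: nilpotent_N n ^+ j.
Proof.
transitivity (\sum_(0 <= j < k.+1)
    ('C(k, j)%:R * x ^+ j) *: nilpotent_N n ^+ j : 'M[R]_n).
  rewrite toeplitz_TE exprD1n big_mkord; apply: eq_bigr => j _.
  by rewrite scalemx_exp -scalerA scaler_nat.
rewrite (@big_cat_nat _ _ _ (minn k (n - 1)).+1) ?ltnS ?geq_minl //=.
rewrite [X in _ + X]big_nat_cond [X in _ + X]big1 ?addr0 // => j.
rewrite andbT => /andP[gt_j le_jk]; rewrite nilpotent_N_exp_eq0 ?scaler0 //.
(* As [j <= k], the bound [minn k (n - 1) < j] can only come from [n - 1]. *)
by move: gt_j; rewrite gtn_min ltnNge -ltnS le_jk /= subn1 prednK.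
Qed.
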